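(* Suppose that the Fisher information matrix $\mathcal{J}(0)$ is positive definite. Then for every $1\le j\le d$, $$\sigma_{g,j}^2\ \ge\ r^{-2}\,(\nabla\theta_j(0))^T\,\mathcal{J}^{-1}(0)\,\nabla\theta_j(0).$$ In particular, if there exists an absolute positive constant $c$ such that $(\nabla\theta_j(0))^T\mathcal{J}^{-1}(0)\nabla\theta_j(0)\ge c$ for all $1\le j\le d$, then $\underline{\sigma}_g^2:=\min_{1\le j\le d}\sigma_{g,j}^2\ge c\,r^{-2}$.
   Context: $X_1,\dots,X_r$ are i.i.d. random variables in a measurable space $(S,\mathcal{S})$ with common distribution $P$, where $r\ge2$; $h:S^r\to\mathbb{R}^d$ is symmetric and measurable with $\mathbb{E}|h_j(X_1,\dots,X_r)|<\infty$ for all $j$. $\theta=\mathbb{E}[h(X_1,\dots,X_r)]$, $g(x_1)=\mathbb{E}[h(x_1,X_2,\dots,X_r)]$, $\sigma_{g,j}^2=\mathbb{E}[(g_j(X_1)-\theta_j)^2]$. $P$ has density $f_0$ with respect to a $\sigma$-finite measure $\mu$ on $(S,\mathcal{S})$, and $f_0$ is embedded in a family of densities (with respect to $\mu$) $\{f_\beta:\beta\in B\}$, where $B\subset\mathbb{R}^\ell$ is an open neighborhood of $0$. $\mathbb{E}_\beta$ and $\mathrm{Var}_\beta$ denote the expectation and the variance (covariance matrix) when $X_1,\dots,X_r$ are i.i.d. with density $f_\beta$, and $$\theta(\beta):=\mathbb{E}_\beta[h(X_1,\dots,X_r)]=\int h(x_1,\dots,x_r)\prod_{i=1}^rf_\beta(x_i)\,\mu(dx_i),$$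 $$\Psi(\beta):=\sum_{i=1}^r\nabla\ln f_\beta(X_i),\qquad \mathcal{J}(\beta):=r^{-1}\mathrm{Var}_\beta(\Psi(\beta)),$$ where $\nabla$ is the gradient with respect to $\beta$. Standing regularity assumption: all involved derivatives and integrals exist and are finite, and the order of integrals, and of integration and differentiation, may be exchanged; in particular $\nabla\int\prod_{i}f_\beta(x_i)\mu(dx_i)=\int\nabla\big(\prod_if_\beta(x_i)\big)\prod_i\mu(dx_i)$ and $\nabla\theta_j(\beta)=\int h_j(x_1,\dots,x_r)\nabla\big(\prod_if_\beta(x_i)\big)\prod_i\mu(dx_i)$, and $\sigma_{g,j}^2$ and $\mathcal{J}(0)$ are finite. *)

(* Defs.v *)
From HB Require Import structures.
From mathcomp Require Import all_boot all_order all_algebra fingroup perm.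
From mathcomp Require Import all_classical all_reals all_analysis.

Set Implicit Arguments.
Unset Strict Implicit.
Unset Printing Implicit Defensive.

Import Order.TTheory GRing.Theory Num.Theory.
Import numFieldNormedType.Exports.

Local Open Scope classical_set_scope.
Local Open Scope ring_scope.

(* The n-fold product of a sigma-finite measure, on the product sigma-algebra
   of n.-tuple S: mu^0 is the unit mass at the empty tuple, and mu^(n+1) is the
   image of mu \x mu^n under (x, t) |-> x :: t. *)
Section power_measure.
Context (d : measure_display) (S : measurableType d) (R : realType).
Variable mu : {sigma_finite_measure set S -> \bar R}.

Definition tcons (n : nat) (p : S * n.-tuple S) : n.+1.-tuple S :=
  [the n.+1.-tuple S of p.1 :: p.2].

Lemma measurable_tcons n : measurable_fun [set: S * n.-tuple S] (@tcons n).
Proof. exact: measurable_cons. Qed.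

HB.instance Definition _ n :=
  @isMeasurableFun.Build _ _ _ _ (@tcons n) (@measurable_tcons n).

Definition cons_measure (n : nat) (m : {sigma_finite_measure set (n.-tuple S) -> \bar R})
    : set (n.+1.-tuple S) -> \bar R :=
  pushforward (mu \x m)%E (@tcons n).

Section cons_measure_sigma_finite.
Context (n : nat) (m : {sigma_finite_measure set (n.-tuple S) -> \bar R}).

Let cons_measure0 : cons_measure m set0 = 0%E.
Proof. exact: measure0. Qed.

Let cons_measure_ge0 A : (0 <= cons_measure m A)%E.
Proof. exact: measure_ge0. Qed.

Let cons_measure_sigma_additive : semi_sigma_additive (cons_measure m).
Proof. exact: measure_semi_sigma_additive. Qed.

HB.instance Definition _ := isMeasure.Build _ _ _ (cons_measure m)
  cons_measure0 cons_measure_ge0 cons_measure_sigma_additive.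

Let cons_measure_sigma_finite : sigma_finite setT (cons_measure m).
Proof.
have /sigma_finiteP[F [TF ndF Foo]] := sigma_finiteT mu.
have /sigma_finiteP[G [TG ndG Goo]] := sigma_finiteT m.
have TFG : \bigcup_k (F k `*` G k) = setT.
  rewrite -setXTT TF TG predeqE => -[x y]; split.
    by move=> [n0 _ []/= ? ?]; split; exists n0.
  move=> [/= [n0 _ Fnx] [k _ Gky]]; exists (maxn n0 k) => //; split.
  - by move: x Fnx; exact/subsetPset/ndF/leq_maxl.
  - by move: y Gky; exact/subsetPset/ndG/leq_maxr.
pose uncons (t : n.+1.-tuple S) : S * n.-tuple S :=
  (thead t, [tuple of behead t]).
have munc : measurable_fun setT uncons.
  apply/measurable_fun_pairP; split; first exact: measurable_tnth.
  exact: measurable_behead.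
exists (fun k => uncons @^-1` (F k `*` G k)).
  by rewrite -preimage_bigcup TFG preimage_setT.
move=> k; have [mF Fk] := Foo k; have [mG Gk] := Goo k; split.
  by rewrite -[X in measurable X]setTI; apply: munc => //; exact: measurableX.
rewrite /cons_measure /pushforward -comp_preimage.
rewrite (_ : uncons \o _ = id); last first.
  by apply/funext => -[x t]; congr pair; exact/val_inj.
rewrite preimage_id product_measure1E//.
by rewrite lte_mul_pinfty// ge0_fin_numE.
Qed.

HB.instance Definition _ := Measure_isSigmaFinite.Build _ _ _
  (cons_measure m) cons_measure_sigma_finite.

End cons_measure_sigma_finite.

Fixpoint power_measure n : {sigma_finite_measure set (n.-tuple S) -> \bar R} :=
  if n is n'.+1 then cons_measure (power_measure n') else \d_([tuple]).

End power_measure.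

Definition first_index r (hr : (2 <= r)%N) : 'I_r := Ordinal (ltnW hr).

Section random_elements.
Context (dO dS : measure_display) (Omega : measurableType dO)
  (S : measurableType dS) (R : realType) (r : nat).
Variables (P : probability Omega R) (X : 'I_r -> {mfun Omega >-> S}).

Definition mutually_independent :=
  forall A : 'I_r -> set S, (forall i, measurable (A i)) ->
    P [set w | forall i, A i (X i w)] = (\prod_(i < r) P (X i @^-1` A i))%E.

Definition has_density (mu : {measure set S -> \bar R})
    (Q : set S -> \bar R) (p : S -> R) :=
  [/\ measurable_fun setT p, forall x, 0 <= p x &
      forall A, measurable A -> Q A = (\int[mu]_(x in A) (p x)%:E)%E].

Definition iid_density (mu : {measure set S -> \bar R}) (p : S -> R) :=
  mutually_independent /\ forall i, has_density mu (distribution P (X i)) p.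

Definition sample (w : Omega) : r.-tuple S := [tuple X i w | i < r].

Context (d : nat).
Variable h : r.-tuple S -> 'cV[R]_d.

Definition symmetric_kernel :=
  forall (s : {perm 'I_r}) (x : r.-tuple S),
    h [tuple tnth x (s i) | i < r] = h x.

Definition mean_h : 'cV[R]_d :=
  \col_j fine 'E_P[fun w => h (sample w) j 0].

(* g(x) = E[h(x, X_2, ..., X_r)], i1 being the position of X_1. *)
Definition proj_h (i1 : 'I_r) (x : S) : 'cV[R]_d :=
  \col_j fine 'E_P[fun w => h [tuple if i == i1 then x else X i w | i < r] j 0].

Definition sigma2_g (i1 : 'I_r) (j : 'I_d) : \bar R :=
  'E_P[fun w => (proj_h i1 (X i1 w) j 0 - mean_h j 0) ^+ 2].

End random_elements.

Section gradient.
Context (R : realType) (l : nat).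

Definition has_grad (F : 'cV[R]_l -> R) (b : 'cV[R]_l) :=
  forall k, derivable F b (delta_mx k 0).

Definition grad (F : 'cV[R]_l -> R) (b : 'cV[R]_l) : 'cV[R]_l :=
  \col_k 'D_(delta_mx k 0) F b.

Definition posdef_mx (A : 'M[R]_l) :=
  A^T = A /\ forall v : 'cV[R]_l, v != 0 -> 0 < (v^T *m A *m v) 0 0.

End gradient.

Section statistical_model.
Context (dO dS : measure_display) (Omega : measurableType dO)
  (S : measurableType dS) (R : realType) (r l : nat).
Variables (Pr : 'cV[R]_l -> probability Omega R)
  (X : 'I_r -> {mfun Omega >-> S}) (f : 'cV[R]_l -> S -> R).

(* ln is 0 on nonpositive reals, so the summand at X_i is meaningful only when
   f b (X_i) > 0, which holds almost surely under Pr b. *)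
Definition score (b : 'cV[R]_l) (w : Omega) : 'cV[R]_l :=
  \sum_(i < r) grad (fun b' => ln (f b' (X i w))) b.

Definition score_cov (b : 'cV[R]_l) (k m : 'I_l) : \bar R :=
  covariance (Pr b) (fun w => score b w k 0) (fun w => score b w m 0).

Definition fisher (b : 'cV[R]_l) : 'M[R]_l :=
  r%:R^-1 *: \matrix_(k, m) fine (score_cov b k m).

Definition lik (b : 'cV[R]_l) (x : r.-tuple S) : R :=
  \prod_(i < r) f b (tnth x i).

Context (d : nat).
Variables (mu : {sigma_finite_measure set S -> \bar R})
  (h : r.-tuple S -> 'cV[R]_d) (B : set 'cV[R]_l).

Definition theta (b : 'cV[R]_l) : 'cV[R]_d := mean_h (Pr b) X h.

Definition info_quad (b : 'cV[R]_l) (j : 'I_d) : R :=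
  let v := grad (fun b' => theta b' j 0) b in
  (v^T *m invmx (fisher b) *m v) 0 0.

Local Notation mur := (power_measure mu r).

(* The last field asks that the r terms of h_j grad (lik) given by the product
   rule be integrable: these are the integrals in which the order of
   integration is exchanged (Fubini) when conditioning on X_i. *)
Record regular : Prop := Regular {
  grad_density : forall b, B b -> forall x, has_grad (f ^~ x) b ;
  integrable_h : forall b, B b -> forall j,
    (Pr b).-integrable setT (fun w => (h (sample X w) j 0)%:E) ;
  integrable_grad_lik : forall b, B b -> forall k,
    mur.-integrable setT (fun x => (grad (lik ^~ x) b k 0)%:E) ;
  grad_int_lik : forall b, B b ->
    has_grad (fun b' => \int[mur]_x lik b' x) b /\
    forall k, grad (fun b' => \int[mur]_x lik b' x) b k 0 =
              \int[mur]_x grad (lik ^~ x) b k 0 ;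
  integrable_h_grad_lik : forall b, B b -> forall j k,
    mur.-integrable setT (fun x => (h x j 0 * grad (lik ^~ x) b k 0)%:E) ;
  grad_theta : forall b, B b -> forall j,
    has_grad (fun b' => theta b' j 0) b /\
    forall k, grad (fun b' => theta b' j 0) b k 0 =
              \int[mur]_x (h x j 0 * grad (lik ^~ x) b k 0) ;
  integrable_h_grad_density : forall b, B b -> forall j k i,
    mur.-integrable setT (fun x => (h x j 0 *
      (grad (f ^~ (tnth x i)) b k 0 *
       \prod_(m < r | m != i) f b (tnth x m)))%:E)
}.

End statistical_model.

(* Main.v *)
Require Import Defs.
From HB Require Import structures.
From mathcomp Require Import all_boot all_order all_algebra fingroup perm.
From mathcomp Require Import all_classical all_reals all_analysis.
From mathcomp Require Import measurable_realfun.
From mathcomp Require Import ring lra.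

Set Implicit Arguments.
Unset Strict Implicit.
Unset Printing Implicit Defensive.

Import Order.TTheory GRing.Theory Num.Theory.
Import numFieldNormedType.Exports.

Local Open Scope classical_set_scope.
Local Open Scope ring_scope.

(** This is the Cramer-Rao inequality for the projection g_j.

Let s be the score of a single observation, that is the gradient of ln f_b(x)
in b at b = 0, and let L_b(x) be the product of the f_b(x_i).  The product rule
gives grad L_0(x) = (s(x_1) + ... + s(x_r)) L_0(x) ([grad_lik]).  It has three
consequences.
- L_b integrates to 1 for b near 0, so the total score is centred
  ([integral_score]), and hence so is s(X_1) ([integral_score1]).
- grad theta_j(0) = E[h_j(X) (s(X_1) + ... + s(X_r))].  As h is symmetric, the
  r terms are equal, and conditioning on X_1 turns each of them into
  E[g_j(X_1) s(X_1)] ([grad_thetaE]); the centring of s allows g_j to be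
  replaced by g_j - theta_j.
- As the s(X_i) are independent and centred, the covariance of the total score
  is r E[s(X_1) s(X_1)^T], so J(0) = E[s(X_1) s(X_1)^T] ([fisherE]).
Thus v = grad theta_j(0) / r collects the inner products of g_j - theta_j with
the coordinates of s in L^2, and J(0) is the Gram matrix of these coordinates.
The number v^T J(0)^-1 v is then the squared norm of the orthogonal projection
of g_j - theta_j on their span, which is at most the squared norm
sigma_{g,j}^2 of g_j - theta_j ([gram_le]).

Three points need care.
- Where f_0(x) = 0 the logarithm says nothing.  There b = 0 minimizes
  f_b(x) >= 0, so grad f_b(x) vanishes and grad f = s f_0 holds whatever the
  value of s ([derive_eq_ln]).
- s(X_1) must be square integrable, while the hypotheses bound the variance of
  the sum of the s(X_i) only.  By Fubini, s + c is square integrable for almost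
  every value c of the sum of the other terms ([Lfun2_of_sum]).
- Changes of density, permutations of the sample and conditioning on one
  observation are identities between laws on S^r.  All follow from the fact
  that a finite measure on S^r is determined by its values on boxes
  ([tuple_measure_unique]): the law of the sample has density L_0 with respect
  to mu^r ([sample_law_density]), is invariant under permutations
  ([sample_law_perm]), and is that of the sample in which one observation is
  replaced by an independent copy ([sample_law_resample]). *)

(** * Integrals with respect to image laws and densities *)

Section pushforward_integral.
Context (d1 d : measure_display) (T1 : measurableType d1)
  (T : measurableType d) (R : realType).
Variables (m1 : {measure set T1 -> \bar R}) (Y : {mfun T1 >-> T}).
Local Open Scope ereal_scope.

Lemma ge0_integral_law (F : T -> \bar R) : measurable_fun setT F ->
  (forall x, 0 <= F x) -> \int[pushforward m1 Y]_x F x = \int[m1]_w F (Y w).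
Proof. by move=> mF F0; rewrite ge0_integral_pushforward. Qed.

(** No integrability is asked for: the positive and negative parts are
    transported separately, so both sides agree even when not finite. *)
Lemma integral_law (F : T -> \bar R) : measurable_fun setT F ->
  \int[pushforward m1 Y]_x F x = \int[m1]_w F (Y w).
Proof.
move=> mF; rewrite [LHS]integralE [RHS]integralE.
under [X in _ = X - _]eq_integral do rewrite funepos_comp/=.
under [X in _ = _ - X]eq_integral do rewrite funeneg_comp/=.
rewrite !ge0_integral_law//; first exact: measurable_funeneg.
exact: measurable_funepos.
Qed.

Lemma integrable_law (F : T -> \bar R) : measurable_fun setT F ->
  (pushforward m1 Y).-integrable setT F <-> m1.-integrable setT (F \o Y).
Proof.
move=> mF.
have E : \int[pushforward m1 Y]_x `|F x| = \int[m1]_w `|F (Y w)|.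
  rewrite -(@ge0_integral_law (abse \o F))//; first exact: measurableT_comp.
  by move=> x; exact: abse_ge0.
split=> /integrableP[_ ioo]; apply/integrableP; split => //.
- exact: measurableT_comp.
- by rewrite -E.
- by rewrite E.
Qed.

End pushforward_integral.

Section equal_laws.
Context (d1 d2 d : measure_display) (T1 : measurableType d1)
  (T2 : measurableType d2) (T : measurableType d) (R : realType).
Variables (m1 : {measure set T1 -> \bar R}) (m2 : {measure set T2 -> \bar R}).
Variables (Y : {mfun T1 >-> T}) (Z : {mfun T2 >-> T}).
Hypothesis eqYZ : forall A, measurable A -> m1 (Y @^-1` A) = m2 (Z @^-1` A).
Local Open Scope ereal_scope.

Lemma eq_law_integral (F : T -> \bar R) : measurable_fun setT F ->
  \int[m1]_w F (Y w) = \int[m2]_w F (Z w).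
Proof.
move=> mF; rewrite -!integral_law//.
by apply: eq_measure_integral => A mA _; exact: eqYZ.
Qed.

Lemma eq_law_integrable (F : T -> \bar R) : measurable_fun setT F ->
  m1.-integrable setT (F \o Y) -> m2.-integrable setT (F \o Z).
Proof.
move=> mF /integrableP[_ ioo]; apply/integrableP; split.
  exact: measurableT_comp.
by rewrite -(@eq_law_integral (abse \o F))//; exact: measurableT_comp.
Qed.

End equal_laws.

Section density.
Context (d : measure_display) (T : measurableType d) (R : realType).
Variables (mu : {measure set T -> \bar R}) (p : T -> R).
Hypotheses (mp : measurable_fun setT p) (p0 : forall x, 0 <= p x).
Local Open Scope ereal_scope.

Let mpE : measurable_fun setT (EFin \o p).
Proof. exact/measurable_EFinP. Qed.

Definition density_measure (A : set T) : \bar R := \int[mu]_(x in A) (p x)%:E.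

Let density0 : density_measure set0 = 0.
Proof. by rewrite /density_measure integral_set0. Qed.

Let density_ge0 A : 0 <= density_measure A.
Proof. by apply: integral_ge0 => x _; rewrite lee_fin. Qed.

Let density_sigma_additive : semi_sigma_additive density_measure.
Proof.
move=> /= F mF tF mUF; rewrite /density_measure; apply: cvg_toP.
  apply: ereal_nondecreasing_is_cvgn => m n mn.
  by apply: lee_sum_nneg_natr => // k _ _; exact: density_ge0.
rewrite ge0_integral_bigcup//=.
- exact: measurable_funTS.
- by move=> x _; rewrite lee_fin.
Qed.

HB.instance Definition _ := isMeasure.Build _ _ _ density_measure
  density0 density_ge0 density_sigma_additive.

(** Consumers get a measure known only by its values, which keeps the proofs
    that [p] is measurable and nonnegative out of the terms. *)
Lemma ex_density_measure :
  exists nu : {measure set T -> \bar R},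
    forall A, nu A = \int[mu]_(x in A) (p x)%:E.
Proof. by exists density_measure. Qed.

End density.

Section integral_density.
Context (d : measure_display) (T : measurableType d) (R : realType).
Variables (mu nu : {measure set T -> \bar R}) (p : T -> R).
Hypotheses (mp : measurable_fun setT p) (p0 : forall x, 0 <= p x).
Local Open Scope ereal_scope.
Hypothesis nuE : forall A, measurable A -> nu A = \int[mu]_(x in A) (p x)%:E.

Let mpE : measurable_fun setT (EFin \o p).
Proof. exact/measurable_EFinP. Qed.

Import HBNNSimple.

Let integral_has_density_nnsfun (f : {nnsfun T >-> R}) :
  \int[nu]_x (f x)%:E = \int[mu]_x ((f x)%:E * (p x)%:E).
Proof.
under [LHS]eq_integral do rewrite fimfunE -fsumEFin//.
rewrite [LHS]ge0_integral_fsum//; last 2 first.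
  - by move=> r; exact/measurable_EFinP/measurableT_comp.
  - by move=> n x _; rewrite EFinM nnfun_muleindic_ge0.
under [RHS]eq_integral.
  move=> x xD; rewrite fimfunE -fsumEFin// ge0_mule_fsuml; last first.
    by move=> r; rewrite EFinM nnfun_muleindic_ge0.
  over.
rewrite [RHS]ge0_integral_fsum//; last 2 first.
  - move=> r; apply: emeasurable_funM => //.
    by apply/measurable_EFinP; apply/measurableT_comp.
  - move=> n x _; rewrite EFinM mule_ge0//; last by rewrite lee_fin.
    by rewrite nnfun_muleindic_ge0.
apply: eq_fsbigr => r _.
have [r0|r0] := ltP r 0%R.
  have -> : f @^-1` [set r] = set0.
    apply/seteqP; split=> // x /= fxr.
    have : (0 <= f x)%R by exact: fun_ge0.
    by rewrite fxr leNgt r0.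
  under eq_integral do rewrite indic0 mulr0.
  by under [RHS]eq_integral do rewrite indic0 mulr0 mul0e; rewrite !integral0.
have mf := @measurable_funPTI _ _ _ _ f [set r] (measurable_set1 r).
under eq_integral do rewrite EFinM.
have r0E : 0 <= r%:E by rewrite lee_fin.
have mfr : measurable_fun setT (fun x => (\1_(f @^-1` [set r]) x)%:E : \bar R).
  exact/measurable_EFinP.
rewrite ge0_integralZl//.
under [RHS]eq_integral do rewrite EFinM -muleA.
have mfp : measurable_fun setT
    (fun x => (\1_(f @^-1` [set r]) x)%:E * (p x)%:E).
  exact: emeasurable_funM.
rewrite [RHS]ge0_integralZl//; last first.
  by move=> x _; rewrite mule_ge0// lee_fin.
congr (_ * _); rewrite integral_indic// setIT nuE//.
rewrite integral_mkcond; apply: eq_integral => x _.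
by rewrite patchE indicE; case: ifPn; rewrite ?mul1e ?mul0e.
Qed.

(** The identity passes from simple functions to their monotone limits. *)
Lemma ge0_integral_has_density (F : T -> \bar R) : measurable_fun setT F ->
  (forall x, 0 <= F x) ->
  \int[nu]_x F x = \int[mu]_x (F x * (p x)%:E).
Proof.
move=> mF F0.
pose f_ := nnsfun_approx measurableT mF.
transitivity (lim (\int[nu]_x (f_ n x)%:E @[n --> \oo])).
  rewrite -monotone_convergence//=.
  - apply: eq_integral => ? /[!inE] xD; apply/esym/cvg_lim => //=.
    exact: cvg_nnsfun_approx.
  - by move=> n; exact/measurable_EFinP/measurable_funTS.
  - by move=> n ? _; rewrite lee_fin.
  - by move=> ? _ ? ? mn; rewrite lee_fin; exact/lefP/nd_nnsfun_approx.
under eq_fun do rewrite integral_has_density_nnsfun.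
rewrite -monotone_convergence//=.
- apply: eq_integral => x _; apply/cvg_lim => //=.
  by apply: cvgeZr => //; exact: cvg_nnsfun_approx.
- by move=> n; apply: emeasurable_funM => //; exact/measurable_EFinP.
- by move=> n x _; rewrite mule_ge0// lee_fin.
- move=> x _ a b ab; apply: lee_wpmul2r; rewrite lee_fin//.
  exact/lefP/nd_nnsfun_approx.
Qed.

Lemma integral_has_density (F : T -> R) : measurable_fun setT F ->
  \int[nu]_x (F x)%:E = \int[mu]_x (F x * p x)%:E.
Proof.
move=> mF; have mFE : measurable_fun setT (EFin \o F) by exact/measurable_EFinP.
rewrite [LHS]integralE [RHS]integralE.
rewrite !ge0_integral_has_density//; last 2 first.
  by apply: measurable_funeneg.
  by apply: measurable_funepos.
congr (_ - _); apply: eq_integral => x _.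
  by rewrite !funeposE -!EFin_max -EFinM maxr_pMl// mul0r.
by rewrite !funenegE -!EFinN -!EFin_max -EFinM maxr_pMl// mul0r mulNr.
Qed.

Lemma integrable_has_density (F : T -> R) : measurable_fun setT F ->
  mu.-integrable setT (fun x => (F x * p x)%:E) ->
  nu.-integrable setT (fun x => (F x)%:E).
Proof.
move=> mF /integrableP[_ ioo]; apply/integrableP; split.
  exact/measurable_EFinP.
rewrite ge0_integral_has_density//.
  under eq_integral => x _ do
    rewrite -[(p x)%:E]gee0_abs ?lee_fin// -abseM -EFinM.
  exact: ioo.
by apply: measurableT_comp => //; exact/measurable_EFinP.
Qed.

End integral_density.

(** * Measures on tuples *)

Section boxes.
Context (d : measure_display) (S : measurableType d) (R : realType) (n : nat).

Definition box (A : 'I_n -> set S) : set (n.-tuple S) :=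
  [set x | forall i, A i (tnth x i)].

Lemma measurable_box A : (forall i, measurable (A i)) -> measurable (box A).
Proof.
move=> mA.
rewrite (_ : box A = \bigcap_(i in [set: 'I_n]) (@tnth n S ^~ i @^-1` A i)).
  apply: fin_bigcap_measurable => // i _.
  by rewrite -[X in measurable X]setTI; exact: measurable_tnth.
by apply/seteqP; split=> x /= Ax i => [_|]; exact: Ax.
Qed.

(** Boxes are stable under intersection and generate the product
    sigma-algebra, so the pi-lambda theorem applies. *)
Lemma tuple_measure_unique (m1 m2 : {measure set (n.-tuple S) -> \bar R}) :
  (m1 setT < +oo)%E ->
  (forall A, (forall i, measurable (A i)) -> m1 (box A) = m2 (box A)) ->
  forall E, measurable E -> m1 E = m2 E.
Proof.
move=> m1oo m12 E mE.
pose G : set (set (n.-tuple S)) :=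
  [set box A | A in [set A | forall i, measurable (A i)]].
have GT : G setT.
  by exists (fun=> setT) => //; apply/seteqP; split.
have GI : setI_closed G.
  move=> _ _ [A mA <-] [B mB <-]; exists (fun i => A i `&` B i).
    by move=> i /=; apply: measurableI.
  apply/seteqP; split=> x /=.
    by move=> AB; split=> i; have [] := AB i.
  by move=> [Ax Bx] i; split.
have mG : measurable = <<s G >>.
  apply/seteqP; split.
    apply: smallest_sub => [|B]; first exact: smallest_sigma_algebra.
    rewrite -bigcup_seq => -[i _ [A mA <-]]; rewrite setTI.
    (* a cylinder over one coordinate is a box with all other sides full *)
    apply: sub_sigma_algebra; exists (fun j => if j == i then A else setT).
      by move=> j /=; case: ifP.
    apply/seteqP; split=> x /=; first by move/(_ i); rewrite eqxx.
    by move=> Ax j; case: ifP => // /eqP ->.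
  apply: smallest_sub; first exact: sigma_algebra_measurable.
  by move=> _ [A mA <-]; exact: measurable_box.
apply: (measure_unique G (fun=> setT) mG GI) => //.
  by apply/seteqP; split=> // x _; exists 0%N.
by move=> _ [A mA <-]; exact: m12.
Qed.

End boxes.

Section power_measure_theory.
Context (d : measure_display) (S : measurableType d) (R : realType).
Variable mu : {sigma_finite_measure set S -> \bar R}.
Local Open Scope ereal_scope.

Lemma ge0_integral_power_measureS n (F : n.+1.-tuple S -> \bar R) :
  measurable_fun setT F -> (forall x, 0 <= F x) ->
  \int[power_measure mu n.+1]_x F x =
  \int[mu]_x \int[power_measure mu n]_t F (tcons (x, t)).
Proof.
move=> mF F0.
transitivity
  (\int[pushforward (mu \x power_measure mu n) (@tcons _ S n)]_x F x).
  exact: eq_measure_integral.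
have mFc : measurable_fun setT (F \o @tcons _ S n).
  by apply: measurableT_comp => //; exact: measurable_tcons.
rewrite ge0_integral_pushforward// preimage_setT fubini_tonelli1//.
by move=> x /=.
Qed.

Lemma integral_power_measure_prod n (q : 'I_n -> S -> R) :
  (forall i, measurable_fun setT (q i)) -> (forall i x, (0 <= q i x)%R) ->
  \int[power_measure mu n]_x (\prod_(i < n) q i (tnth x i))%:E =
  \prod_(i < n) \int[mu]_x (q i x)%:E.
Proof.
elim: n q => [|n IHn] q mq q0.
  rewrite big_ord0; under eq_integral do rewrite big_ord0.
  rewrite integral_cst// mul1e.
  by rewrite /= diracT.
rewrite ge0_integral_power_measureS//; last 2 first.
- apply/measurable_EFinP; apply: measurable_prod => i _.
  by apply: measurableT_comp => //; exact: measurable_tnth.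
- by move=> x; rewrite lee_fin; apply: prodr_ge0.
rewrite big_ord_recl -IHn//.
rewrite -ge0_integralZr//; last 3 first.
- exact/measurable_EFinP.
- by move=> x _; rewrite lee_fin.
- by apply: integral_ge0 => x _; rewrite lee_fin; apply: prodr_ge0.
apply: eq_integral => x _.
rewrite -ge0_integralZl//; last 3 first.
- apply/measurable_EFinP; apply: measurable_prod => i _.
  by apply: measurableT_comp => //; exact: measurable_tnth.
- by move=> t _; rewrite lee_fin; apply: prodr_ge0.
- by rewrite lee_fin.
apply: eq_integral => t _; rewrite -EFinM big_ord_recl; congr (_ * _)%:E%R.
by apply: eq_bigr => i _; rewrite tnthS.
Qed.

End power_measure_theory.

(** * The law of an independent sample *)

Section sample_law.
Context (dO dS : measure_display) (Omega : measurableType dO)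
  (S : measurableType dS) (R : realType) (r : nat).
Variable P : probability Omega R.
Implicit Type X : 'I_r -> {mfun Omega >-> S}.

Lemma measurable_sample X : measurable_fun setT (sample X).
Proof.
apply/measurable_fun_tnthP => i.
rewrite (_ : _ \o _ = X i)//.
by apply/funext => w /=; rewrite tnth_mktuple.
Qed.

HB.instance Definition _ X :=
  @isMeasurableFun.Build _ _ _ _ (sample X) (measurable_sample X).

(** An independent sample seen from observation [i1]: the fresh point [z.1]
    replaces that observation and [z.2] drives the others.  Under the product
    measure, integrating over [z.2] is conditioning on that observation. *)
Definition resample X (i1 : 'I_r) (z : S * Omega) : r.-tuple S :=
  [tuple if i == i1 then z.1 else X i z.2 | i < r].

Lemma measurable_resample X i1 : measurable_fun setT (resample X i1).
Proof.
apply/measurable_fun_tnthP => i.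
rewrite (_ : _ \o _ = fun z => if i == i1 then z.1 else X i z.2); last first.
  by apply/funext => w /=; rewrite tnth_mktuple.
by case: eqP => _; [exact: measurable_fst|exact: measurableT_comp].
Qed.

HB.instance Definition _ X i1 :=
  @isMeasurableFun.Build _ _ _ _ (resample X i1) (measurable_resample X i1).

Lemma sample_box X (A : 'I_r -> set S) : mutually_independent P X ->
  (forall i, measurable (A i)) ->
  P (sample X @^-1` box A) = (\prod_(i < r) P (X i @^-1` A i))%E.
Proof.
move=> indX mA; rewrite -indX//; congr (P _).
by apply/seteqP; split=> w /= + i => /(_ i); rewrite tnth_mktuple.
Qed.

Lemma sample_law_unique X (m : {measure set (r.-tuple S) -> \bar R}) :
  mutually_independent P X ->
  (forall A, (forall i, measurable (A i)) ->
    m (box A) = (\prod_(i < r) P (X i @^-1` A i))%E) ->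
  forall E, measurable E -> P (sample X @^-1` E) = m E.
Proof.
move=> indX mA E mE.
apply: (@tuple_measure_unique _ S R r (pushforward P (sample X)) m) => //.
  by rewrite /= /pushforward preimage_setT probability_setT ltry.
by move=> A mA'; rewrite /= /pushforward mA// sample_box.
Qed.

Lemma sample_permE X (s : {perm 'I_r}) w :
  sample (X \o s) w = [tuple tnth (sample X w) (s i) | i < r].
Proof. by apply: eq_from_tnth => i; rewrite !tnth_mktuple. Qed.

(** Permuting the observations permutes the factors of the mass of a box. *)
Lemma sample_law_perm X (s : {perm 'I_r}) :
  mutually_independent P X ->
  (forall i j A, measurable A -> P (X i @^-1` A) = P (X j @^-1` A)) ->
  forall E, measurable E -> P (sample X @^-1` E) = P (sample (X \o s) @^-1` E).
Proof.
move=> indX idX; apply: (sample_law_unique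
  (m := pushforward P (sample (X \o s)))) => // A mA.
rewrite /= /pushforward.
have -> : sample (X \o s) @^-1` box A = sample X @^-1` box (A \o (s^-1)%g).
  apply/seteqP; split=> w /= + i.
    by move/(_ ((s^-1)%g i)); rewrite !tnth_mktuple /= permKV.
  by move/(_ (s i)); rewrite !tnth_mktuple /= permK.
rewrite [LHS](sample_box indX); last by move=> i /=.
rewrite (reindex_inj (@perm_inj _ s)) /=; apply: eq_bigr => i _.
by rewrite permK; exact: idX.
Qed.

(** Under the product measure a box splits into its side at [i1] and the same
    box with that side made full. *)
Lemma sample_law_resample X (i1 : 'I_r) : mutually_independent P X ->
  forall E, measurable E ->
  P (sample X @^-1` E) =
  (distribution P (X i1) \x P)%E (resample X i1 @^-1` E).
Proof.
move=> indX; apply: (sample_law_unique (m := pushforward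
  (distribution P (X i1) \x P)%E (resample X i1))) => // A mA.
rewrite /= /pushforward.
pose A' i := if i == i1 then setT else A i.
have mA' i : measurable (A' i) by rewrite /A'; case: ifP.
have -> : resample X i1 @^-1` box A = A i1 `*` (sample X @^-1` box A').
  apply/seteqP; split=> -[x w] /=.
    move=> Axw; split; first by have := Axw i1; rewrite tnth_mktuple eqxx.
    move=> i; have := Axw i; rewrite !tnth_mktuple /A'.
    by case: ifP.
  move=> [Ax Aw] i; have := Aw i; rewrite !tnth_mktuple /A' /=.
  by case: eqP => // ->.
rewrite [LHS]product_measure1E//; last first.
  by rewrite -[X in measurable X]setTI; apply: measurable_sample => //;
     exact: measurable_box.
transitivity (P (X i1 @^-1` A i1) * P (sample X @^-1` box A'))%E; first by [].
rewrite sample_box// [RHS](bigD1 i1)//=; congr (_ * _)%E.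
rewrite (bigD1 i1)//= /A' eqxx preimage_setT probability_setT mul1e.
by apply: eq_bigr => i /negbTE ->.
Qed.

End sample_law.

Section sample_density.
Context (dO dS : measure_display) (Omega : measurableType dO)
  (S : measurableType dS) (R : realType) (r : nat).
Variables (P : probability Omega R) (X : 'I_r -> {mfun Omega >-> S}).
Variables (mu : {sigma_finite_measure set S -> \bar R}) (p : S -> R).
Hypothesis Xp : iid_density P X mu p.
Local Open Scope ereal_scope.

Lemma measurable_prod_tnth : (0 < r)%N ->
  measurable_fun setT (fun x : r.-tuple S => \prod_(i < r) p (tnth x i))%R.
Proof.
have [_ dX] := Xp => r0; have [mp _ _] := dX (Ordinal r0).
apply: measurable_prod => i _.
by apply: measurableT_comp => //; exact: measurable_tnth.
Qed.

(** The mass of a box is an integral of a product of functions of one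
    coordinate each, which Tonelli turns into a product of integrals. *)
Lemma sample_law_density E : (0 < r)%N -> measurable E ->
  P (sample X @^-1` E) =
  \int[power_measure mu r]_(x in E) (\prod_(i < r) p (tnth x i))%:E.
Proof.
move=> r0 mE; have [indX dX] := Xp; have [mp p0 _] := dX (Ordinal r0).
have ml := measurable_prod_tnth r0.
have l0 (x : r.-tuple S) : (0 <= \prod_(i < r) p (tnth x i))%R.
  by apply: prodr_ge0.
have [nu nuE] := ex_density_measure (power_measure mu r) ml l0.
rewrite -nuE; apply: sample_law_unique => // A mA.
rewrite nuE.
transitivity (\int[power_measure mu r]_x
    (\prod_(i < r) (p (tnth x i) * \1_(A i) (tnth x i))%R)%:E).
  rewrite integral_mkcond; apply: eq_integral => x _.
  rewrite patchE big_split/=; case: ifPn => [/[!inE] Ax|].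
    rewrite [X in (_ * X)%R]big1 ?mulr1// => i _.
    by rewrite indicE mem_set.
  rewrite notin_setE => /existsNP[i Ax].
  by rewrite [X in (_ * X)%R](bigD1 i)//= indicE memNset// mul0r mulr0.
rewrite (integral_power_measure_prod mu (q := fun i x => p x * \1_(A i) x)%R)//.
- apply: eq_bigr => i _; have [_ _ pE] := dX i.
  rewrite -[P _]/(distribution P (X i) (A i)) pE// [RHS]integral_mkcond.
  apply: eq_integral => x _; rewrite patchE indicE.
  by case: ifPn; rewrite ?mulr1 ?mulr0.
- by move=> i; apply: measurable_funM.
- by move=> i x; rewrite mulr_ge0.
Qed.

End sample_density.

Section sample_integral.
Context (dO dS : measure_display) (Omega : measurableType dO)
  (S : measurableType dS) (R : realType) (r : nat).
Variables (P : probability Omega R) (X : 'I_r -> {mfun Omega >-> S}).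
Variables (mu : {sigma_finite_measure set S -> \bar R}) (p : S -> R).
Hypotheses (r0 : (0 < r)%N) (Xp : iid_density P X mu p).
Variable F : r.-tuple S -> R.
Hypothesis mF : measurable_fun setT F.
Local Open Scope ereal_scope.

Local Notation lik := (fun x : r.-tuple S => \prod_(i < r) p (tnth x i))%R.

Let mFE : measurable_fun setT (EFin \o F).
Proof. exact/measurable_EFinP. Qed.

Let lik_ge0 x : (0 <= lik x)%R.
Proof.
have [_ dX] := Xp; have [_ p0 _] := dX (Ordinal r0).
exact: prodr_ge0.
Qed.

Let law_lik E : measurable E ->
  pushforward P (sample X) E = \int[power_measure mu r]_(x in E) (lik x)%:E.
Proof. exact: sample_law_density. Qed.

Lemma integral_sample :
  \int[P]_w (F (sample X w))%:E = \int[power_measure mu r]_x (F x * lik x)%:E.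
Proof.
rewrite -(integral_law P (sample X) mFE).
exact: (integral_has_density (measurable_prod_tnth Xp r0) lik_ge0 law_lik).
Qed.

Lemma integrable_sample :
  (power_measure mu r).-integrable setT (fun x => (F x * lik x)%:E) ->
  P.-integrable setT (fun w => (F (sample X w))%:E).
Proof.
move=> iF; apply/(integrable_law P (sample X) mFE).
exact: (integrable_has_density (measurable_prod_tnth Xp r0) lik_ge0 law_lik).
Qed.

End sample_integral.

(** * Directional derivatives of a function and of its logarithm *)

Section lines.
Context (R : numFieldType) (V W : normedModType R).
Implicit Types (f : V -> W) (a v : V).

Lemma near_line (Q : V -> Prop) a v : (\forall x \near a, Q x) ->
  \forall h \near (0 : R), Q (h *: v + a).
Proof.
move=> Qa; have {}Qa : nbhs ((0 : R) *: v + a) Q by rewrite scale0r add0r.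
have c : {for 0, continuous (fun h : R => h *: v + a)}.
  by apply: continuousD => //; [exact: scalel_continuous|exact: cst_continuous].
exact: c Qa.
Qed.

Lemma derivable_cvg_line f a v : derivable f a v ->
  f (h *: v + a) @[h --> (0 : R)] --> f a.
Proof.
move=> /derivable1P/derivable1_diffP/differentiable_continuous c.
have <- : f ((0 : R) *: v + a) = f a by rewrite scale0r add0r.
exact: c.
Qed.

(** Restricting [f] to a line, so that the one-variable chain rule applies. *)
Lemma derive_line f a v :
  'D_v f a = 'D_1 (fun h : R => f (h *: v + a)) 0.
Proof.
rewrite /derive; set g1 := fun h => h^-1 *: _; set g2 := fun h => h^-1 *: _.
suff -> : g1 = g2 by [].
by apply/funext => h; rewrite /g1 /g2/= addr0 scale0r add0r [_%:A]mulr1.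
Qed.

End lines.

Section directional_derivatives.
Context (R : realType) (V : normedModType R).
Implicit Types (f : V -> R) (a v : V).

(** The difference quotients are nonnegative on the right and nonpositive on
    the left, and both one-sided limits are the derivative. *)
Lemma derive_local_min f a v : derivable f a v ->
  (\forall x \near a, f a <= f x) -> 'D_v f a = 0.
Proof.
move=> df fmin; have fminl := near_line v fmin.
pose q (h : R) := h^-1 *: ((f \o shift a) (h *: v) - f a).
have qD : q h @[h --> 0^'] --> 'D_v f a by exact: df.
apply/eqP; rewrite eq_le; apply/andP; split.
  apply: (cvgr_to_le (cvg_dnbhs_at_left qD)); near=> h.
  apply: mulr_le0_ge0.
    by rewrite invr_le0; apply: ltW; near: h; exact: nbhs_left_lt.
  by rewrite subr_ge0 /=; near: h; exact: cvg_within fminl.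
apply: (cvgr_to_ge (cvg_dnbhs_at_right qD)); near=> h.
apply: mulr_ge0.
  by rewrite invr_ge0; apply: ltW; near: h; exact: nbhs_right_gt.
by rewrite subr_ge0 /=; near: h; exact: cvg_within fminl.
Unshelve. all: by end_near. Qed.

Lemma derive_ln f a v : 0 < f a -> derivable f a v ->
  'D_v (fun x => ln (f x)) a = 'D_v f a / f a.
Proof.
move=> fa0 df.
have f0a : f ((0 : R) *: v + a) = f a by rewrite scale0r add0r.
have dl : is_derive (0 : R) 1 (fun h : R => f (h *: v + a)) ('D_v f a).
  by rewrite derive_line; exact: derivableP ((derivable1P _ _ _).1 df).
have dln : is_derive (f ((0 : R) *: v + a)) 1 (@ln R) (f a)^-1.
  by rewrite -f0a; apply: is_derive1_ln; rewrite f0a.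
rewrite mulrC derive_line.
by have [_ <-] := is_derive1_comp dln dl.
Qed.

(** As [ln] is 0 at 0 and very negative at small positive points, [ln \o f] is
    either identically 0 near [a] on the line, or not derivable there. *)
Lemma derive_ln_eq0 f a v : f a = 0 -> (\forall x \near a, 0 <= f x) ->
  derivable f a v -> 'D_v (fun x => ln (f x)) a = 0.
Proof.
move=> fa0 f0 df.
have [dln|ndln] := pselect (derivable (fun x => ln (f x)) a v); last first.
  (* a limit that does not exist is the default point of [R], which is 0 *)
  by rewrite /derive dvgP.
have fl0 := near_line v f0.
have fl := derivable_cvg_line df; rewrite fa0 in fl.
have lnl := derivable_cvg_line dln; rewrite fa0 ln0// in lnl.
have lz : \forall h \near (0 : R), ln (f (h *: v + a)) = 0.
  near=> h.
  have : 0 <= f (h *: v + a) by near: h.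
  rewrite le_eqVlt => /predU1P[<-|fh]; first by rewrite ln0.
  (* near 0 a positive value of f would have a logarithm both below and above
     -1 *)
  have fh1 : f (h *: v + a) < expR (-1).
    by near: h; apply: (cvgr_lt 0) => //; exact: expR_gt0.
  have lnh : -1 < ln (f (h *: v + a)).
    by near: h; apply: (cvgr_gt 0) => //; rewrite ltrN10.
  by move: lnh; rewrite -ltr_expR lnK ?posrE// ltNge (ltW fh1).
rewrite /derive; apply: lim_near_cst => //=.
have {}lz : \forall h \near (0 : R)^', ln (f (h *: v + a)) = 0.
  exact: cvg_within lz.
by apply: filterS lz => h /= ->; rewrite fa0 ln0// subrr scaler0.
Unshelve. all: by end_near. Qed.

(** This is the chain rule if [f a] is positive; otherwise [a] is a minimum of
    [f] and both sides vanish. *)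
Lemma derive_eq_ln f a v : (\forall x \near a, 0 <= f x) -> derivable f a v ->
  'D_v f a = 'D_v (fun x => ln (f x)) a * f a.
Proof.
move=> f0 df; have := nbhs_singleton f0; rewrite le_eqVlt => /predU1P[fa0|fa0].
  rewrite -fa0 mulr0; apply: derive_local_min => //.
  by near=> x; rewrite -fa0; near: x.
by rewrite derive_ln// divfK// gt_eqF.
Unshelve. all: by end_near. Qed.

(** The product rule with derivatives given as [g i * F i a]: unlike with
    logarithmic derivatives, the factors may vanish. *)
Lemma derive_prod_log (I : Type) (s : seq I) (F : I -> V -> R) (g : I -> R)
    a v :
  (forall i, is_derive a v (F i) (g i * F i a)) ->
  is_derive a v (fun x => \prod_(i <- s) F i x)
    ((\sum_(i <- s) g i) * \prod_(i <- s) F i a).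
Proof.
move=> dF; elim: s => [|i s IHs].
  under eq_fun do rewrite big_nil.
  by rewrite !big_nil mul0r; exact: is_derive_cst.
under eq_fun do rewrite big_cons.
apply: (is_derive_eq (is_deriveM (dF i) IHs)).
by rewrite !big_cons /GRing.scale/=; ring.
Qed.

End directional_derivatives.

(** A pointwise limit of difference quotients along 1/(n+1) is measurable. *)
Lemma measurable_derive (d : measure_display) (S : measurableType d)
    (R : realType) (V : normedModType R) (f : V -> S -> R) (a v : V) :
  (\forall b \near a, measurable_fun setT (f b)) ->
  (forall x, derivable (f ^~ x) a v) ->
  measurable_fun setT (fun x => 'D_v (f ^~ x) a).
Proof.
move=> mf df; have /near_line-/(_ v) mfl := mf.
have ma : measurable_fun setT (f a) := nbhs_singleton mf.
have h0 : (@harmonic R) @ \oo --> (0 : R)^'.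
  move=> A A0.
  have : \forall n \near \oo, (harmonic n : R) != 0 -> A (harmonic n).
    exact: (@cvg_harmonic R _ A0).
  by apply: filterS => n; apply; rewrite gt_eqF// harmonic_gt0.
have [N _ Nm] : \forall n \near \oo,
    measurable_fun setT (f (harmonic n *: v + a)) := cvg_harmonic mfl.
(* the quotients are measurable from rank N on only *)
pose q n x := (harmonic (n + N))^-1 * (f (harmonic (n + N) *: v + a) x - f a x).
apply: (@measurable_fun_cvg _ _ R _ q) => [n|x _].
  apply: measurable_funM => //; apply: measurable_funB => //.
  by apply: Nm => /=; exact: leq_addl.
have -> : q ^~ x = fun n => (fun h : R =>
    h^-1 *: ((f ^~ x \o shift a) (h *: v) - f a x)) (harmonic (n + N)) by [].
have hD : (fun h : R => h^-1 *: ((f ^~ x \o shift a) (h *: v) - f a x)) @ 0^'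
   --> 'D_v (f ^~ x) a by exact: df.
have := cvg_comp _ _ h0 hD.
by rewrite -(cvg_shiftn N).
Qed.

(** * Square-integrable functions and Gram matrices *)

Lemma posdef_unit (R : realType) l (J : 'M[R]_l) : posdef_mx J -> J \in unitmx.
Proof.
move=> [_ Jpos]; rewrite unitmxE unitfE; apply/negP => /det0P[v v0 vJ].
have := Jpos v^T; rewrite trmxK vJ mul0mx mxE ltxx.
by rewrite -(inj_eq trmx_inj) trmxK trmx0 => /(_ v0).
Qed.

Section square_integrable.
Context (d : measure_display) (T : measurableType d) (R : realType).
Variable nu : probability T R.
Implicit Types F G : T -> R.

Lemma Lfun2P F : F \in Lfun nu 2%:E <->
  measurable_fun setT F /\ nu.-integrable setT (fun x => (F x ^+ 2)%:E).
Proof.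
split=> [F2|[mF /integrableP[_ ioo]]].
  by split; [have := F2; rewrite inE => /andP[/[!inE]]|
             exact: Lfun2_integrable_sqr].
rewrite inE; apply/andP; split; rewrite inE//= /finite_norm unlock poweR_lty//.
apply: le_lt_trans ioo; rewrite le_eqVlt; apply/orP; left; apply/eqP.
apply: eq_integral => x _ /=.
by rewrite powR_mulrn// -normrX.
Qed.

Lemma Lfun2_measurable F : F \in Lfun nu 2%:E -> measurable_fun setT F.
Proof. by case/Lfun2P. Qed.

Lemma Lfun2_Lfun1 F : F \in Lfun nu 2%:E -> F \in Lfun nu 1.
Proof. by apply: Lfun_subset12; exact: fin_num_measure. Qed.

Lemma Lfun2_integrable F : F \in Lfun nu 2%:E ->
  nu.-integrable setT (fun x => (F x)%:E).
Proof. by move=> /Lfun2_Lfun1/Lfun1_integrable. Qed.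

Lemma Lfun2_integrableM F G : F \in Lfun nu 2%:E -> G \in Lfun nu 2%:E ->
  nu.-integrable setT (fun x => (F x * G x)%:E).
Proof. by move=> F2 G2; exact/Lfun1_integrable/Lfun2_mul_Lfun1. Qed.

Lemma Rintegral_sum (I : Type) (s : seq I) (F : I -> T -> R) :
  (forall i, nu.-integrable setT (fun x => (F i x)%:E)) ->
  \int[nu]_x (\sum_(i <- s) F i x) = \sum_(i <- s) \int[nu]_x F i x.
Proof.
move=> iF; rewrite /Rintegral; under eq_integral do rewrite -sumEFin.
rewrite integral_sum// sum_fine// => i _; exact: integrable_fin_num.
Qed.

Lemma Lfun2_lincomb l (s : 'I_l -> T -> R) (a : 'I_l -> R) :
  (forall k, s k \in Lfun nu 2%:E) ->
  (fun x => \sum_k a k * s k x) \in Lfun nu 2%:E.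
Proof.
move=> s2; rewrite (_ : (fun x => _) = \sum_k (a k \o* s k)); last first.
  by apply/funext => x; rewrite fct_sumE; apply: eq_bigr => k _; rewrite mulrC.
have p1 : (1 <= 2%:E :> \bar R)%E by exact: lee1n.
by rewrite rpred_sum// => k _; apply: Lfun_scale => //; rewrite lerDl.
Qed.

Lemma Rintegral_mul_lincomb l F (s : 'I_l -> T -> R) (a : 'I_l -> R) :
  F \in Lfun nu 2%:E -> (forall k, s k \in Lfun nu 2%:E) ->
  \int[nu]_x (F x * \sum_k a k * s k x) = \sum_k a k * \int[nu]_x (F x * s k x).
Proof.
move=> F2 s2; have iFs k := Lfun2_integrableM F2 (s2 k).
under eq_Rintegral.
  move=> x _; rewrite mulr_sumr; under eq_bigr do rewrite mulrCA.
  over.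
rewrite Rintegral_sum.
  by apply: eq_bigr => k _; rewrite RintegralZl//; exact: iFs.
by move=> k; under eq_fun do rewrite EFinM; apply: integrableZl.
Qed.

(** Bessel's inequality: with [a = J^-1 v], the combination of the [s k] with
    coefficients [a k] is the orthogonal projection of [F] on their span, and
    its squared norm is [v^T J^-1 v]. *)
Lemma gram_le l F (s : 'I_l -> T -> R) (J : 'M[R]_l) (v : 'cV[R]_l) :
  F \in Lfun nu 2%:E -> (forall k, s k \in Lfun nu 2%:E) ->
  posdef_mx J ->
  (forall k m, J k m = \int[nu]_x (s k x * s m x)) ->
  (forall k, v k 0 = \int[nu]_x (F x * s k x)) ->
  (v^T *m invmx J *m v) 0 0 <= \int[nu]_x (F x ^+ 2).
Proof.
move=> F2 s2 Jpos JE vE; have Ju := posdef_unit Jpos.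
pose a := invmx J *m v; pose G x := \sum_k a k 0 * s k x.
have G2 : G \in Lfun nu 2%:E by exact: Lfun2_lincomb.
have Ja : J *m a = v by rewrite /a mulmxA mulmxV// mul1mx.
have FG : \int[nu]_x (F x * G x) = (v^T *m invmx J *m v) 0 0.
  rewrite Rintegral_mul_lincomb// -mulmxA -/a mxE; apply: eq_bigr => k _.
  by rewrite -vE [v^T 0 k]mxE mulrC.
have Gs k : \int[nu]_x (G x * s k x) = v k 0.
  under eq_Rintegral do rewrite mulrC.
  rewrite Rintegral_mul_lincomb// -Ja mxE; apply: eq_bigr => m _.
  by rewrite -JE mulrC.
have GG : \int[nu]_x (G x * G x) = (v^T *m invmx J *m v) 0 0.
  rewrite [LHS]Rintegral_mul_lincomb// -mulmxA -/a mxE; apply: eq_bigr => k _.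
  by rewrite Gs [v^T 0 k]mxE mulrC.
have : 0 <= \int[nu]_x ((F x - G x) ^+ 2).
  by apply: Rintegral_ge0 => x _; exact: sqr_ge0.
have -> : \int[nu]_x ((F x - G x) ^+ 2) =
    \int[nu]_x (F x ^+ 2) - \int[nu]_x (F x * G x)
    - (\int[nu]_x (F x * G x) - \int[nu]_x (G x * G x)).
  have iFF := Lfun2_integrable_sqr F2.
  have iFG := Lfun2_integrableM F2 G2.
  have iGG := Lfun2_integrableM G2 G2.
  have iB (U W : T -> R) : nu.-integrable setT (fun x => (U x)%:E) ->
      nu.-integrable setT (fun x => (W x)%:E) ->
      nu.-integrable setT (fun x => (U x - W x)%:E).
    by move=> iU iW; exact: (integrableB measurableT iU iW).
  rewrite -!RintegralB//; [|exact: iB..].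
  by apply: eq_Rintegral => x _; ring.
by rewrite FG GG; lra.
Qed.

End square_integrable.

(** * Moments of functions of independent observations *)

Section iid_moments.
Context (dO dS : measure_display) (Omega : measurableType dO)
  (S : measurableType dS) (R : realType) (r : nat).
Variables (P : probability Omega R) (X : 'I_r -> {mfun Omega >-> S}).
Variable i1 : 'I_r.
Hypothesis indX : mutually_independent P X.
Hypothesis idX : forall i j A, measurable A ->
  P (X i @^-1` A) = P (X j @^-1` A).

Local Notation nu := (distribution P (X i1)).

Lemma integral_idX i (F : S -> \bar R) : measurable_fun setT F ->
  (\int[P]_w F (X i w) = \int[nu]_x F x)%E.
Proof.
move=> mF; transitivity (\int[P]_w F (X i1 w))%E.
  by apply: eq_law_integral => // A mA; exact: idX.
exact/esym/integral_law.
Qed.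

Lemma Lfun2_idX i (s : S -> R) : s \in Lfun nu 2%:E ->
  (fun w => s (X i w)) \in Lfun P 2%:E.
Proof.
move=> /Lfun2P[ms is2]; apply/Lfun2P; split; first exact: measurableT_comp.
have ms2 : measurable_fun setT (fun x => (s x ^+ 2)%:E).
  by apply/measurable_EFinP; exact: measurable_funX.
apply: (@eq_law_integrable _ _ _ _ _ _ _ P P (X i1) (X i) _ _ ms2).
  by move=> A mA; exact: idX.
exact/(integrable_law P (X i1) ms2).1.
Qed.

Lemma resample_nth i (z : S * Omega) :
  tnth (resample X i1 z) i = if i == i1 then z.1 else X i z.2.
Proof. by rewrite tnth_mktuple. Qed.

Lemma integral_resample (F : r.-tuple S -> \bar R) : measurable_fun setT F ->
  (\int[P]_w F (sample X w) = \int[nu \x P]_z F (resample X i1 z))%E.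
Proof.
move=> mF; apply: (@eq_law_integral _ _ _ _ _ _ _ P (nu \x P)%E) => // A mA.
exact: sample_law_resample.
Qed.

Lemma integrable_resample (F : r.-tuple S -> \bar R) : measurable_fun setT F ->
  P.-integrable setT (F \o sample X) ->
  (nu \x P)%E.-integrable setT (F \o resample X i1).
Proof.
move=> mF; apply: eq_law_integrable => // A mA.
exact: sample_law_resample.
Qed.

Lemma measurable_fun_tnth (s : S -> R) (i : 'I_r) : measurable_fun setT s ->
  measurable_fun setT (fun x : r.-tuple S => s (tnth x i)).
Proof.
by move=> ms; apply: measurableT_comp => //; exact: measurable_tnth.
Qed.

(** Resample observation [i1]: the squared sum becomes integrable on a product
    space, so for almost every value of the other observations the function
    [s + c] is square integrable, [c] being the sum of the other terms.  A
    single such value is enough. *)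
Lemma Lfun2_of_sum (s : S -> R) : measurable_fun setT s ->
  P.-integrable setT (fun w => ((\sum_(i < r) s (X i w)) ^+ 2)%:E) ->
  s \in Lfun nu 2%:E.
Proof.
move=> ms isum.
pose F (x : r.-tuple S) := ((\sum_(i < r) s (tnth x i)) ^+ 2)%:E : \bar R.
have mF : measurable_fun setT F.
  apply/measurable_EFinP; apply: measurable_funX; apply: measurable_sum => i.
  exact: measurable_fun_tnth.
have FE : F \o sample X = fun w => ((\sum_(i < r) s (X i w)) ^+ 2)%:E.
  apply/funext => w; congr ((_ ^+ 2)%:E).
  by apply: eq_bigr => i _; rewrite tnth_mktuple.
rewrite -FE in isum.
have [N [mN N0 sN]] := ae_integrable2 (integrable_resample mF isum).
have [w Nw] : exists w, ~ N w.
  apply/not_existsP => allN; have NT : N = setT.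
    by apply/seteqP; split=> // w _; exact: contrapT (allN w).
  have : P setT = 0%E by rewrite -NT.
  by rewrite probability_setT => /eqP; rewrite onee_eq0.
pose c := \sum_(i < r | i != i1) s (X i w).
have sc2 : (fun x => s x + c) \in Lfun nu 2%:E.
  apply/Lfun2P; split; first exact: measurable_funD.
  have : nu.-integrable setT (fun x => (F \o resample X i1) (x, w)).
    by apply: contrapT => /sN.
  congr (_.-integrable); apply/funext => x; congr ((_ ^+ 2)%:E).
  rewrite (bigD1 i1)//= resample_nth eqxx; congr +%R.
  by apply: eq_bigr => i /negbTE ii1; rewrite resample_nth ii1.
have p1 : (1 <= 2%:E :> \bar R)%E by exact: lee1n.
have -> : s = (fun x => s x + c) - cst c.
  by apply/funext => x; rewrite !fctE addrK.
by rewrite rpredB// Lfun_cst.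
Qed.

(** Conditioning on observation [i1]: [g] is the conditional expectation of [H]
    given that observation.  Where the inner integral of [H] diverges, [fine]
    makes [g] arbitrary, but by Fubini this happens on a negligible set only. *)
Lemma proj_integral (H : r.-tuple S -> R) (s : S -> R)
    (g := fun x => fine (\int[P]_w (H (resample X i1 (x, w)))%:E)) :
  measurable_fun setT H -> measurable_fun setT s ->
  P.-integrable setT (fun w => (H (sample X w))%:E) ->
  P.-integrable setT (fun w => (H (sample X w) * s (X i1 w))%:E) ->
  measurable_fun setT g /\
  \int[P]_w (H (sample X w) * s (X i1 w)) = \int[nu]_x (g x * s x).
Proof.
move=> mH ms iH iHs.
have mHE : measurable_fun setT (EFin \o H) by exact/measurable_EFinP.
have iHr := integrable_resample mHE iH.
have mg : measurable_fun setT g.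
  have := measurable_fubini_F iHr.
  by move=> mF; apply: (measurableT_comp (fine_measurable _)).
split=> //.
pose F (x : r.-tuple S) := (H x * s (tnth x i1))%:E : \bar R.
have mF : measurable_fun setT F.
  apply/measurable_EFinP; apply: measurable_funM => //.
  exact: measurable_fun_tnth.
have FE : F \o sample X = fun w => (H (sample X w) * s (X i1 w))%:E.
  by apply/funext => w; rewrite /F/= tnth_mktuple.
rewrite -FE in iHs; have iF := integrable_resample mF iHs.
rewrite /Rintegral -FE integral_resample// -(integral12_prod_meas1 iF).
congr fine; apply: ae_eq_integral => //.
- exact: measurable_fubini_F iF.
- by apply/measurable_EFinP; apply: measurable_funM.
have := ae_integrable1 iHr; apply: filterS => x iHx _.
rewrite /fubini_F/= EFinM /g fineK; last exact: integrable_fin_num.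
rewrite -integralZr//; apply: eq_integral => w _.
by rewrite /F EFinM resample_nth eqxx.
Qed.

End iid_moments.

Section uncorrelated.
Context (dO dS : measure_display) (Omega : measurableType dO)
  (S : measurableType dS) (R : realType) (r : nat).
Variables (P : probability Omega R) (X : 'I_r -> {mfun Omega >-> S}).
Variable i1 : 'I_r.
Hypothesis indX : mutually_independent P X.
Hypothesis idX : forall i j A, measurable A ->
  P (X i @^-1` A) = P (X j @^-1` A).

Local Notation nu := (distribution P (X i1)).

(** Conditionally on [X j], the factor [s (X i)] has a constant mean, which
    comes out of the integral of [t]. *)
Lemma integral_pair_eq0 (i j : 'I_r) (s t : S -> R) : i != j ->
  s \in Lfun nu 2%:E -> t \in Lfun nu 2%:E ->
  \int[nu]_x t x = 0 ->
  \int[P]_w (s (X i w) * t (X j w)) = 0.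
Proof.
move=> ij s2 t2 t0.
have ms := Lfun2_measurable s2; have mt := Lfun2_measurable t2.
have i2 := Lfun2_idX idX i s2; have j2 := Lfun2_idX idX j t2.
have sE : (fun w => s (tnth (sample X w) i)) = fun w => s (X i w).
  by apply/funext => w; rewrite tnth_mktuple.
have [||_] := @proj_integral _ _ _ _ _ _ P X j indX
    (fun x => s (tnth x i)) t (measurable_fun_tnth i ms) mt.
- move: (Lfun2_integrable i2); congr (_.-integrable).
  by apply/funext => w; rewrite -(congr1 (@^~ w) sE).
- move: (Lfun2_integrableM i2 j2); congr (_.-integrable).
  by apply/funext => w; rewrite -(congr1 (@^~ w) sE).
under eq_Rintegral do rewrite tnth_mktuple.
move=> ->.
pose c := \int[P]_w s (X i w).
transitivity (\int[distribution P (X j)]_x (c * t x)).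
  apply: eq_Rintegral => x _; congr (fine _ * _).
  by apply: eq_integral => w _; rewrite resample_nth (negbTE ij).
have mtE : measurable_fun setT (EFin \o t) by exact/measurable_EFinP.
rewrite RintegralZl//; last exact/(integrable_law P (X j) mtE)/Lfun2_integrable.
rewrite [X in _ * X](_ : _ = 0) ?mulr0// -t0.
rewrite /Rintegral; congr fine; rewrite -(integral_idX i1 idX j mtE).
exact: (integral_law P (X j) mtE).
Qed.

(** Only the diagonal terms survive, and they are all equal. *)
Lemma integral_sum_prod (s t : S -> R) :
  s \in Lfun nu 2%:E -> t \in Lfun nu 2%:E ->
  \int[nu]_x t x = 0 ->
  \int[P]_w ((\sum_(i < r) s (X i w)) * (\sum_(j < r) t (X j w))) =
  r%:R * \int[nu]_x (s x * t x).
Proof.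
move=> s2 t2 t0.
have iXst i j := Lfun2_integrableM (Lfun2_idX idX i s2) (Lfun2_idX idX j t2).
under eq_Rintegral do rewrite mulr_suml.
rewrite Rintegral_sum => [|i]; last first.
  under eq_fun do rewrite mulr_sumr -sumEFin.
  by apply: integrable_sum => // j _; exact: iXst.
rewrite -[r in r%:R]card_ord mulr_natl -sumr_const; apply: eq_bigr => i _.
under eq_Rintegral do rewrite mulr_sumr.
rewrite Rintegral_sum; last exact: iXst.
rewrite (bigD1 i)//= big1 ?addr0 => [|j ji]; last first.
  by apply: integral_pair_eq0 => //; rewrite eq_sym.
rewrite /Rintegral; congr fine.
apply: (integral_idX i1 idX i (F := fun x => (s x * t x)%:E)).
apply/measurable_EFinP; apply: measurable_funM.
  exact: Lfun2_measurable s2.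
exact: Lfun2_measurable t2.
Qed.

End uncorrelated.

(** * Score, Fisher information and the bound *)

Section information_bound.
Context (R : realType) (dO dS : measure_display) (Omega : measurableType dO)
  (S : measurableType dS) (r l d : nat).
Variables (hr : (2 <= r)%N) (mu : {sigma_finite_measure set S -> \bar R})
  (B : set 'cV[R]_l) (f : 'cV[R]_l -> S -> R)
  (Pr : 'cV[R]_l -> probability Omega R) (X : 'I_r -> {mfun Omega >-> S})
  (h : r.-tuple S -> 'cV[R]_d).
Hypotheses (Bopen : open B) (B0 : B 0)
  (Xiid : forall b, B b -> iid_density (Pr b) X mu (f b))
  (hsym : symmetric_kernel h)
  (hmeas : forall j, measurable_fun setT (fun x => h x j 0))
  (hreg : regular Pr X f mu h B).

Local Notation i1 := (first_index hr).
Local Notation P := (Pr 0).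
Local Notation nu := (distribution P (X i1)).
Local Notation mur := (power_measure mu r).

Let r0 : (0 < r)%N := ltnW hr.

Let indX : mutually_independent P X.
Proof. by have [] := Xiid B0. Qed.

Let densX b i : B b -> has_density mu (distribution (Pr b) (X i)) (f b).
Proof. by move=> Bb; have [_] := Xiid Bb. Qed.

Let idX i j A : measurable A -> P (X i @^-1` A) = P (X j @^-1` A).
Proof.
move=> mA; have [_ _ Ei] := densX i B0; have [_ _ Ej] := densX j B0.
exact: etrans (Ei A mA) (esym (Ej A mA)).
Qed.

Let nearB : \forall b \near (0 : 'cV[R]_l), B b.
Proof. exact: open_nbhs_nbhs. Qed.

Let f_ge0 x : \forall b \near (0 : 'cV[R]_l), 0 <= f b x.
Proof. by apply: filterS nearB => b Bb; have [_ + _] := densX i1 Bb. Qed.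

Let df x k : derivable (f ^~ x) 0 (delta_mx k 0).
Proof. exact: (grad_density hreg B0). Qed.

Definition score1 (k : 'I_l) (x : S) : R := grad (fun b => ln (f b x)) 0 k 0.

(** With the convention that division by 0 gives 0, the formula is valid even
    where the density vanishes; it shows that the score is measurable. *)
Lemma score1E k x : score1 k x = grad (f ^~ x) 0 k 0 / f 0 x.
Proof.
rewrite /score1 !mxE; have := nbhs_singleton (f_ge0 x).
rewrite le_eqVlt => /predU1P[fx0|fx0]; last by rewrite derive_ln.
by rewrite -fx0 invr0 mulr0; apply: derive_ln_eq0.
Qed.

Lemma grad_density_score1 k x : grad (f ^~ x) 0 k 0 = score1 k x * f 0 x.
Proof. by rewrite /score1 !mxE; exact: derive_eq_ln. Qed.

Lemma measurable_score1 k : measurable_fun setT (score1 k).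
Proof.
have [mf0 f0_ge0 _] := densX i1 B0.
(* an inverse of a nonnegative number is a real power, 0 included, and powers
   are measurable functions of their base *)
have -> : score1 k = (fun x => 'D_(delta_mx k 0) (f ^~ x) 0 * f 0 x `^ (-1)).
  by apply/funext => x; rewrite score1E mxE powR_inv1.
apply: measurable_funM.
  apply: measurable_derive => //.
  by apply: filterS nearB => b Bb; have [] := densX i1 Bb.
exact: (measurableT_comp (measurable_powR (-1)) mf0).
Qed.

Lemma grad_lik k x : grad (lik f ^~ x) 0 k 0 =
  (\sum_(i < r) score1 k (tnth x i)) * lik f 0 x.
Proof.
rewrite mxE /lik; apply: derive_val; apply: derive_prod_log => i.
apply: DeriveDef; first exact: df.
by rewrite -grad_density_score1 mxE.
Qed.

Lemma scoreE k w : score X f 0 w k 0 = \sum_(i < r) score1 k (X i w).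
Proof. by rewrite summxE. Qed.

Lemma measurable_sum_score1 k :
  measurable_fun setT (fun x : r.-tuple S => \sum_(i < r) score1 k (tnth x i)).
Proof.
apply: measurable_sum => i; apply: measurable_fun_tnth.
exact: measurable_score1.
Qed.

Lemma sample_score1 k w : \sum_(i < r) score1 k (tnth (sample X w) i) =
  \sum_(i < r) score1 k (X i w).
Proof. by apply: eq_bigr => i _; rewrite tnth_mktuple. Qed.

Lemma integral_lik b : B b -> \int[mur]_x lik f b x = 1.
Proof.
move=> Bb; rewrite /Rintegral -(sample_law_density (Xiid Bb) r0 measurableT).
by rewrite preimage_setT probability_setT.
Qed.

(** The likelihood integrates to 1 on a neighbourhood of 0, so the integral of
    its gradient, which is the mean of the total score, vanishes. *)
Lemma integral_score k : \int[P]_w (\sum_(i < r) score1 k (X i w)) = 0.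
Proof.
have [_ /(_ k) gI] := grad_int_lik hreg B0.
have : grad (fun b => \int[mur]_x lik f b x) 0 k 0 = 0.
  rewrite mxE.
  transitivity ('D_(delta_mx k 0) (cst 1 : 'cV[R]_l -> R) 0); last first.
    exact: derive_cst.
  by apply: near_eq_derive; apply: filterS nearB => b; exact: integral_lik.
rewrite {}gI => e; rewrite -[RHS]e /Rintegral; congr fine.
under eq_integral do rewrite -sample_score1.
rewrite (integral_sample r0 (Xiid B0) (@measurable_sum_score1 k)).
by apply: eq_integral => x _; rewrite grad_lik.
Qed.

Lemma score_covE k m : score_cov Pr X f 0 k m =
  (\int[P]_w ((\sum_(i < r) score1 k (X i w)) *
              (\sum_(i < r) score1 m (X i w)))%:E)%E.
Proof.
have ET n : fine 'E_P[fun w => score X f 0 w n 0] = 0.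
  rewrite -[RHS](integral_score n) expectation.unlock; congr fine.
  by apply: eq_integral => w _; rewrite scoreE.
rewrite /score_cov covariance.unlock !ET expectation.unlock.
by apply: eq_integral => w _; rewrite !fctE /= !subr0 !scoreE.
Qed.

Section finite_information.
Hypothesis fisher_fin : forall k m, score_cov Pr X f 0 k m \is a fin_num.

Lemma score1_Lfun2 k : score1 k \in Lfun nu 2%:E.
Proof.
apply: Lfun2_of_sum => //; first exact: measurable_score1.
apply/integrableP; split.
  apply/measurable_EFinP; apply: measurable_funX; apply: measurable_sum => i.
  by apply: measurableT_comp => //; exact: measurable_score1.
under eq_integral do rewrite gee0_abs ?lee_fin ?sqr_ge0// expr2.
by rewrite -score_covE ltey_eq fisher_fin.
Qed.

Lemma integral_score1 k : \int[nu]_x score1 k x = 0.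
Proof.
have s2 := score1_Lfun2 k.
have : r%:R * \int[nu]_x score1 k x = 0.
  rewrite -[RHS](integral_score k) Rintegral_sum; last first.
    by move=> i; exact: Lfun2_integrable (Lfun2_idX idX i s2).
  rewrite -[r in r%:R]card_ord mulr_natl -sumr_const; apply: eq_bigr => i _.
  rewrite /Rintegral; congr fine.
  rewrite -(integral_idX i1 idX i (F := EFin \o score1 k))//.
  exact/measurable_EFinP/measurable_score1.
by move/eqP; rewrite mulf_eq0 pnatr_eq0 gtn_eqF//= => /eqP.
Qed.

Lemma fisherE k m :
  fisher Pr X f 0 k m = \int[nu]_x (score1 k x * score1 m x).
Proof.
rewrite !mxE score_covE -[fine _]/(Rintegral _ _ _).
rewrite (integral_sum_prod indX idX (score1_Lfun2 k) (score1_Lfun2 m))//;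
  last exact: integral_score1.
by rewrite mulKf// pnatr_eq0 gtn_eqF.
Qed.

Lemma integrable_h_score1 j k i :
  P.-integrable setT (fun w => (h (sample X w) j 0 * score1 k (X i w))%:E).
Proof.
pose F (x : r.-tuple S) := h x j 0 * score1 k (tnth x i).
have mF : measurable_fun setT F.
  apply: measurable_funM => //; apply: measurable_fun_tnth.
  exact: measurable_score1.
have -> : (fun w => (h (sample X w) j 0 * score1 k (X i w))%:E) =
    fun w => (F (sample X w))%:E.
  by apply/funext => w; rewrite /F tnth_mktuple.
apply: (integrable_sample r0 (Xiid B0) mF).
have := integrable_h_grad_density hreg B0 j k i; congr (_.-integrable).
apply/funext => x; rewrite grad_density_score1 -!mulrA; congr (_ * (_ * _))%:E.
by rewrite [RHS](bigD1 i).
Qed.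

(** Exchanging observations [i] and [i1] changes neither the law of the sample
    nor [h]; conditioning on observation [i1] then replaces [h] by its
    projection. *)
Lemma integral_h_score1 j k i :
  \int[P]_w (h (sample X w) j 0 * score1 k (X i w)) =
  \int[nu]_x (proj_h P X h i1 x j 0 * score1 k x).
Proof.
have ms := measurable_score1 k.
transitivity (\int[P]_w (h (sample X w) j 0 * score1 k (X i1 w))).
  rewrite /Rintegral; congr fine.
  have mF : measurable_fun setT
      (fun x : r.-tuple S => (h x j 0 * score1 k (tnth x i))%:E).
    apply/measurable_EFinP; apply: measurable_funM => //.
    exact: measurable_fun_tnth.
  have := eq_law_integral (sample_law_perm (tperm i i1) indX idX) mF.
  under eq_integral do rewrite tnth_mktuple.
  move=> ->; apply: eq_integral => w _.
  by rewrite /= sample_permE hsym !tnth_mktuple /= tpermL.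
have iH := integrable_h hreg B0 j.
have [_ ->] := proj_integral indX (hmeas j) ms iH (integrable_h_score1 j k i1).
by apply: eq_Rintegral => x _; rewrite mxE expectation.unlock.
Qed.

Lemma grad_thetaE j k : grad (fun b => theta Pr X h b j 0) 0 k 0 =
  r%:R * \int[nu]_x (proj_h P X h i1 x j 0 * score1 k x).
Proof.
have [_ /(_ k) ->] := grad_theta hreg B0 j.
transitivity (\int[P]_w (\sum_(i < r) (h (sample X w) j 0 * score1 k (X i w)))).
  rewrite /Rintegral; congr fine.
  under [RHS]eq_integral do rewrite -mulr_sumr -sample_score1.
  rewrite (integral_sample r0 (Xiid B0)
    (measurable_funM (hmeas j) (@measurable_sum_score1 k))).
  by apply: eq_integral => x _; rewrite grad_lik mulrA.
rewrite Rintegral_sum; last exact: integrable_h_score1.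
rewrite -[r in r%:R]card_ord mulr_natl -sumr_const; apply: eq_bigr => i _.
exact: integral_h_score1.
Qed.

(** [gram_le] for the centred projection [Y], whose inner products with the
    score are [grad theta / r]. *)
Lemma information_le j :
  sigma2_g P X h i1 j \is a fin_num -> posdef_mx (fisher Pr X f 0) ->
  ((r%:R ^- 2 * info_quad Pr X f h 0 j)%R%:E <= sigma2_g P X h i1 j)%E.
Proof.
move=> sfin Jpos; have iH := integrable_h hreg B0 j.
pose Y x := proj_h P X h i1 x j 0 - mean_h P X h j 0.
have mY : measurable_fun setT Y.
  (* [proj_integral] against the constant 1 *)
  have [|mg _] := proj_integral (i1 := i1) indX (hmeas j)
      (@measurable_cst _ _ _ _ setT (1 : R)) iH.
    by under eq_fun do rewrite mulr1.
  apply: measurable_funB => //.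
  have -> : (fun x => proj_h P X h i1 x j 0) =
    fun x => fine (\int[P]_w (h (resample X i1 (x, w)) j 0)%:E).
    by apply/funext => x; rewrite mxE expectation.unlock.
  by [].
have mY2 : measurable_fun setT (fun x => (Y x ^+ 2)%:E).
  by apply/measurable_EFinP; exact: measurable_funX.
have sE : sigma2_g P X h i1 j = (\int[nu]_x (Y x ^+ 2)%:E)%E.
  by rewrite /sigma2_g expectation.unlock -(integral_idX i1 idX i1 mY2).
have Y2 : Y \in Lfun nu 2%:E.
  apply/Lfun2P; split => //; apply/integrableP; split => //.
  under eq_integral do rewrite gee0_abs ?lee_fin ?sqr_ge0//.
  by rewrite -sE ltey_eq sfin.
have vE k : (r%:R^-1 *: grad (fun b => theta Pr X h b j 0) 0) k 0 =
    \int[nu]_x (Y x * score1 k x).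
  have s2 := score1_Lfun2 k.
  rewrite mxE grad_thetaE mulKf ?pnatr_eq0 ?gtn_eqF//.
  transitivity (\int[nu]_x (Y x * score1 k x + mean_h P X h j 0 * score1 k x)).
    by apply: eq_Rintegral => x _; rewrite -mulrDl subrK.
  have iM : nu.-integrable setT
      (fun x => (mean_h P X h j 0 * score1 k x)%:E).
    under eq_fun do rewrite EFinM.
    by apply: integrableZl => //; exact: Lfun2_integrable.
  rewrite RintegralD//; last exact: Lfun2_integrableM.
  rewrite RintegralZl//; last exact: Lfun2_integrable.
  by rewrite integral_score1 mulr0 addr0.
rewrite -(fineK sfin) lee_fin sE.
apply: le_trans (gram_le Y2 score1_Lfun2 Jpos fisherE vE).
rewrite /info_quad [(_ *: _)^T]linearZ /= -!scalemxAl -scalemxAr scalerA.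
by rewrite [leRHS]mxE -expr2 exprVn.
Qed.

End finite_information.

End information_bound.

Theorem lemma4p1 (R : realType)
    (dO dS : measure_display) (Omega : measurableType dO)
    (S : measurableType dS) (r l d : nat)
    (hr : (2 <= r)%N) (hd : (0 < d)%N)
    (mu : {sigma_finite_measure set S -> \bar R})
    (B : set 'cV[R]_l) (Bopen : open B) (B0 : B 0)
    (f : 'cV[R]_l -> S -> R)
    (Pr : 'cV[R]_l -> probability Omega R)
    (X : 'I_r -> {mfun Omega >-> S})
    (Xiid : forall b, B b -> iid_density (Pr b) X mu (f b))
    (h : r.-tuple S -> 'cV[R]_d)
    (hsym : symmetric_kernel h)
    (hmeas : forall j, measurable_fun setT (fun x => h x j 0))
    (hreg : regular Pr X f mu h B)
    (sigma_fin : forall j, sigma2_g (Pr 0) X h (first_index hr) j \is a fin_num)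
    (fisher_fin : forall k m, score_cov Pr X f 0 k m \is a fin_num)
    (fisher_pos : posdef_mx (fisher Pr X f 0)) :
  (forall j : 'I_d,
     ((r%:R ^- 2 * info_quad Pr X f h 0 j)%R%:E <=
        sigma2_g (Pr 0%R) X h (first_index hr) j)%E)
  /\
  (forall c : R, 0 < c -> (forall j : 'I_d, c <= info_quad Pr X f h 0 j) ->
     ((c * r%:R ^- 2)%R%:E <=
        \big[Order.min/+oo]_(j < d)
          sigma2_g (Pr 0%R) X h (first_index hr) j)%E).
Proof.
have le_j j : ((r%:R ^- 2 * info_quad Pr X f h 0 j)%R%:E <=
    sigma2_g (Pr 0%R) X h (first_index hr) j)%E.
  exact: (information_le Bopen B0 Xiid hsym hmeas hreg fisher_fin).
split=> // c c0 cinfo; apply: le_bigmin; first exact: leey.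
by move=> j _; apply: le_trans (le_j j); rewrite lee_fin mulrC ler_wpM2l.
Qed.
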